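(* Let $A$ be a real $m\times n$ matrix and $B$ a real $n\times\rho$ matrix, let $\Theta^{(\kappa)}=\{\Theta^{(\kappa)}_1,\ldots,\Theta^{(\kappa)}_k\}$ be a partition of $\{1,\ldots,n\}$ with $|\Theta^{(\kappa)}|=k$, and let $c\ge1$ be a fixed sample size. Assume the probability $p^{(o)}=(p^{(o)}_\ell)_{\ell=1}^n$, $$p^{(o)}_\ell=\frac{\|A_{(,\ell)}\|_F\|B_{(\ell,)}\|_F}{\sum_{j=1}^n\|A_{(,j)}\|_F\|B_{(j,)}\|_F},$$ has all entries positive, and define $$p^{(\kappa,o)}_\ell=\sum_{j\in\Theta^{(\kappa)}_\ell}p^{(o)}_j,\qquad 1\le\ell\le k.$$ Let $$\hat S=\frac1c\sum_{i=1}^c\frac1{p^{(\kappa,o)}_{r_i}}A_{(,\Theta^{(\kappa)}_{r_i})}B_{(\Theta^{(\kappa)}_{r_i},)},$$ where $r_1,\ldots,r_c$ are independent samples from $\{1,\ldots,k\}$ drawn according to $p^{(\kappa,o)}$. Then $$\mathbb{E}_{p^{(\kappa,o)}}\big[\|AB-\hat S\|_F^2\big]\le V_{p^{(o)}}(AB).$$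
   Context: A partition of $\{1,\ldots,n\}$ is into nonempty disjoint blocks. $A_{(,\ell)}$ is the $\ell$th column of $A$ and $B_{(\ell,)}$ the $\ell$th row of $B$; for an index set $J$, $A_{(,J)}$ is the matrix formed by the columns of $A$ with indices in $J$ and $B_{(J,)}$ the matrix formed by the rows of $B$ with indices in $J$ (same ordering). $\|\cdot\|_F$ is the Frobenius norm. $V_{p^{(o)}}(AB)$ is the expected squared Frobenius error of single-column sampling with probability $p^{(o)}$, i.e. $V_{p^{(o)}}(AB)=\mathbb{E}_{p^{(o)}}\big[\|AB-\frac1c\sum_{i=1}^c\frac1{p^{(o)}_{t_i}}A_{(,t_i)}B_{(t_i,)}\|_F^2\big]$ with $t_1,\ldots,t_c$ independent samples from $\{1,\ldots,n\}$ drawn according to $p^{(o)}$; equivalently $$V_{p^{(o)}}(AB)=\frac1c\Big(\sum_{\ell=1}^n\|A_{(,\ell)}\|_F\|B_{(\ell,)}\|_F\Big)^2-\frac{\|AB\|_F^2}{c}.$$ *)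

(* Defs.v *)
From mathcomp Require Import all_boot all_order all_algebra.
From mathcomp Require Import all_classical all_reals all_analysis.

Set Implicit Arguments.
Unset Strict Implicit.
Unset Printing Implicit Defensive.

Import Order.TTheory GRing.Theory Num.Theory.

Local Open Scope ring_scope.

(* The norm that the analysis library puts on matrices is the maximum norm, so
   the Frobenius norm is defined here. *)
Definition frob_norm (R : realType) (m n : nat) (M : 'M[R]_(m, n)) : R :=
  Num.sqrt (\sum_(i < m) \sum_(j < n) M i j ^+ 2).

(* [enum_val] lists a subset of ['I_n] in increasing order. *)
Definition cols_in (R : realType) (m n : nat) (J : {set 'I_n})
    (A : 'M[R]_(m, n)) : 'M[R]_(m, #|J|) :=
  colsub (fun i : 'I_#|J| => enum_val i) A.

Definition rows_in (R : realType) (n q : nat) (J : {set 'I_n})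
    (B : 'M[R]_(n, q)) : 'M[R]_(#|J|, q) :=
  rowsub (fun i : 'I_#|J| => enum_val i) B.

Definition opt_prob (R : realType) (m n q : nat)
    (A : 'M[R]_(m, n)) (B : 'M[R]_(n, q)) (l : 'I_n) : R :=
  frob_norm (col l A) * frob_norm (row l B)
    / \sum_(j < n) frob_norm (col j A) * frob_norm (row j B).

Definition block_prob (R : realType) (n k : nat) (Theta : 'I_k -> {set 'I_n})
    (p : 'I_n -> R) (l : 'I_k) : R :=
  \sum_(j in Theta l) p j.

Definition column_estimator (R : realType) (m n q c : nat) (p : 'I_n -> R)
    (A : 'M[R]_(m, n)) (B : 'M[R]_(n, q)) (t : 'I_c -> 'I_n) : 'M[R]_(m, q) :=
  c%:R^-1 *: \sum_(i < c) (p (t i))^-1 *: (col (t i) A *m row (t i) B).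

Definition block_estimator (R : realType) (m n q k c : nat)
    (Theta : 'I_k -> {set 'I_n}) (p : 'I_k -> R)
    (A : 'M[R]_(m, n)) (B : 'M[R]_(n, q)) (r : 'I_c -> 'I_k) : 'M[R]_(m, q) :=
  c%:R^-1 *: \sum_(i < c) (p (r i))^-1 *:
    (cols_in (Theta (r i)) A *m rows_in (Theta (r i)) B).

(* [r 0, ..., r (c - 1)] are random variables on [(T, P)] with values in the
   discrete space ['I_k], mutually independent, each with probability mass
   function [p]. *)
Definition independent_samples (d : measure_display) (T : measurableType d)
    (R : realType) (P : probability T R) (k c : nat) (p : 'I_k -> R)
    (r : 'I_c -> T -> 'I_k) : Prop :=
  [/\ forall (i : 'I_c) (E : set 'I_k), measurable [set w | E (r i w)]%classic,
      forall (i : 'I_c) (l : 'I_k), P [set w | r i w = l]%classic = (p l)%:E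
    & forall (J : {set 'I_c}) (E : 'I_c -> set 'I_k),
        P [set w | forall i, i \in J -> E i (r i w)]%classic
        = (\prod_(i in J) P [set w | E i (r i w)]%classic)%E].

(* The expected squared Frobenius error of sampling single columns [t] with
   probability [p]; by independence it depends only on [p], not on [P], [t]. *)
Definition column_sampling_error (d : measure_display) (T : measurableType d)
    (R : realType) (P : probability T R) (m n q c : nat) (p : 'I_n -> R)
    (A : 'M[R]_(m, n)) (B : 'M[R]_(n, q)) (t : 'I_c -> T -> 'I_n) : \bar R :=
  ('E_P[fun w => (frob_norm
    (A *m B - column_estimator p A B (fun i => t i w)) ^+ 2)%R])%E.

(* Main.v *)
Require Import Defs.
From mathcomp Require Import all_boot all_order all_algebra.
From mathcomp Require Import all_classical all_reals all_analysis.
From mathcomp Require Import ring.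

(** Both estimators are instances of one scheme: a matrix S is written as a sum
    of matrices X_l, indices are drawn independently with probabilities p_l, and
    S is estimated by the mean of the c rescaled draws X_l / p_l. Each draw is
    an unbiased estimate of S, and the mean of c independent unbiased estimates
    has 1/c of the variance of a single one, so the expected squared Frobenius
    error is
        (1/c) (sum_l |X_l|^2 / p_l  -  |S|^2)                 ([sampling_error]).
    For single columns X_j is the rank-one product of column j of A and row j
    of B; for blocks the summands are the sums of the X_j over the blocks, and
    the probability of a block is the sum of the p_j over it. In both cases S
    is AB, so only the first terms of the two errors have to be compared, and
    there the Cauchy-Schwarz inequality in the form
        |sum_(j in J) X_j|^2 / sum_(j in J) p_j <= sum_(j in J) |X_j|^2 / p_j
    ([sqr_frob_norm_sum_div_le]) does it block by block. Merging indices into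
    blocks thus never increases the error, whatever the positive probabilities
    p_j are.

    The expectations reduce to finite sums because the estimator depends on the
    sample point only through the tuple of drawn indices, which takes finitely
    many values and, by independence, has the product law
    ([expectation_samples]). *)

Set Implicit Arguments.
Unset Strict Implicit.
Unset Printing Implicit Defensive.

Import Order.TTheory GRing.Theory Num.Theory.

Local Open Scope ring_scope.

(** * Frobenius norms and products of blocks of columns and rows *)

Lemma sqr_frob_norm (R : realType) (m n : nat) (M : 'M[R]_(m, n)) :
  frob_norm M ^+ 2 = \sum_(i < m) \sum_(j < n) M i j ^+ 2.
Proof.
rewrite /frob_norm sqr_sqrtr //.
by apply: sumr_ge0 => i _; apply: sumr_ge0 => j _; exact: sqr_ge0.
Qed.

Lemma mulmx_cols_rows_in (R : realType) (m n q : nat) (J : {set 'I_n})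
    (A : 'M[R]_(m, n)) (B : 'M[R]_(n, q)) :
  cols_in J A *m rows_in J B = \sum_(j in J) col j A *m row j B.
Proof.
rewrite big_enum_val.
apply/matrixP => a b; rewrite mxE summxE.
by apply: eq_bigr => i _; rewrite !mxE big_ord1 !mxE.
Qed.

Lemma mulmx_sum_col_row (R : realType) (m n q : nat)
    (A : 'M[R]_(m, n)) (B : 'M[R]_(n, q)) :
  A *m B = \sum_j col j A *m row j B.
Proof.
apply/matrixP => a b; rewrite mxE summxE.
by apply: eq_bigr => i _; rewrite !mxE big_ord1 !mxE.
Qed.

(** * Second moments under a finite product law *)

Section FiniteProductLaw.
Variables (R : realType) (k c : nat) (p : 'I_k -> R).

Lemma sum_prod_pmf : \sum_(f : {ffun 'I_c -> 'I_k}) \prod_i p (f i)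
  = (\sum_l p l) ^+ c.
Proof.
by rewrite -(bigA_distr_bigA (fun _ : 'I_c => p)) prodr_const card_ord.
Qed.

Hypothesis p_sum1 : \sum_l p l = 1.

(** Distinct coordinates are uncorrelated: the sum over f factors over the
    coordinates, and a centred factor that stands alone contributes 0. *)
Lemma second_moment_coordinates (z : 'I_k -> R) (i j : 'I_c) :
  \sum_l p l * z l = 0 ->
  \sum_(f : {ffun 'I_c -> 'I_k}) (\prod_h p (f h)) * (z (f i) * z (f j))
  = if i == j then \sum_l p l * z l ^+ 2 else 0.
Proof.
move=> z0.
(* The i-th and j-th coordinates carry a factor z; for i = j one coordinate
   carries both, which gives the square. *)
pose u h l := p l * ((if h == i then z l else 1) * (if h == j then z l else 1)).
transitivity (\prod_h \sum_l u h l).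
  rewrite bigA_distr_bigA; apply: eq_bigr => f _.
  rewrite /u big_split /= big_split /=.
  have pick i0 : \prod_h (if h == i0 then z (f h) else 1) = z (f i0).
    by rewrite -big_mkcond big_pred1_eq.
  by rewrite !pick.
rewrite (bigD1 i) //=; case: eqVneq => [ij|ij].
  rewrite [X in _ * X]big1 ?mulr1 => [|h /negbTE hi].
    by apply: eq_bigr => l _; rewrite /u -ij eqxx.
  by rewrite -p_sum1; apply: eq_bigr => l _; rewrite /u -ij hi !mulr1.
rewrite -[X in X * _]/(\sum_l u i l) (eq_bigr (fun l => p l * z l)).
  by rewrite z0 mul0r.
by move=> l _; rewrite /u eqxx (negbTE ij) mulr1.
Qed.

(** Once y is centred at its mean, the square of the sum expands into the
    products of pairs of coordinates, of which only the c diagonal ones survive;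
    with the factor 1/c^2 this leaves 1/c times the variance of y. *)
Lemma variance_of_mean (c_gt0 : (0 < c)%N) (y : 'I_k -> R) :
  \sum_(f : {ffun 'I_c -> 'I_k}) (\prod_h p (f h)) *
     (\sum_l p l * y l - c%:R^-1 * \sum_i y (f i)) ^+ 2
  = c%:R^-1 * (\sum_l p l * y l ^+ 2 - (\sum_l p l * y l) ^+ 2).
Proof.
set s := \sum_l p l * y l; pose z l := s - y l.
have c_neq0 : c%:R != 0 :> R by rewrite pnatr_eq0 -lt0n.
have z0 : \sum_l p l * z l = 0.
  under eq_bigr do rewrite mulrBr.
  by rewrite sumrB -mulr_suml p_sum1 mul1r subrr.
have z2 : \sum_l p l * z l ^+ 2 = \sum_l p l * y l ^+ 2 - s ^+ 2.
  transitivity (\sum_l (p l * s ^+ 2 - 2 * s * (p l * y l) + p l * y l ^+ 2)).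
    by apply: eq_bigr => l _; rewrite /z; ring.
  by rewrite big_split sumrB /= -mulr_suml -mulr_sumr p_sum1 -/s; ring.
have dev (f : {ffun 'I_c -> 'I_k}) :
    s - c%:R^-1 * \sum_i y (f i) = c%:R^-1 * \sum_i z (f i).
  rewrite sumrB sumr_const card_ord mulrBr -(mulr_natl s) mulrA.
  by rewrite mulVf // mul1r.
rewrite -z2.
transitivity (c%:R^-1 ^+ 2 * \sum_i \sum_j
    \sum_(f : {ffun 'I_c -> 'I_k}) (\prod_h p (f h)) * (z (f i) * z (f j))).
  rewrite (eq_bigr (fun i => \sum_(f : {ffun 'I_c -> 'I_k})
      \sum_j (\prod_h p (f h)) * (z (f i) * z (f j)))); last first.
    by move=> i _; exact: exchange_big.
  rewrite exchange_big mulr_sumr; apply: eq_bigr => f _ /=.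
  rewrite dev exprMn mulrCA; congr (_ * _).
  rewrite expr2 mulr_suml mulr_sumr; apply: eq_bigr => i _.
  by rewrite !mulr_sumr.
under eq_bigr => i _.
  under eq_bigr => j _ do rewrite second_moment_coordinates //.
  rewrite -big_mkcond (big_pred1 i); last by move=> j; rewrite eq_sym.
  over.
by rewrite sumr_const card_ord -[_ *+ c]mulr_natl; field.
Qed.

End FiniteProductLaw.

(** * Expected error of importance sampling *)

Section Samples.
Context (d : measure_display) (T : measurableType d) (R : realType).
Context (P : probability T R) (k c : nat) (p : 'I_k -> R).
Context (r : 'I_c -> T -> 'I_k).
Hypothesis r_samples : independent_samples P p r.

(** A function of the drawn tuple is a finite combination of the indicators of
    the events that the tuple equals f; independence over the full index set
    makes the probability of each such event a product. *)
Lemma expectation_samples (F : {ffun 'I_c -> 'I_k} -> R) :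
  ('E_P[fun w => F [ffun i => r i w]])%E
  = (\sum_(f : {ffun 'I_c -> 'I_k}) (\prod_i p (f i)) * F f)%:E.
Proof.
case: r_samples => r_meas r_law r_indep.
pose S (f : {ffun 'I_c -> 'I_k}) : set T :=
  [set w | forall i, r i w = f i]%classic.
have mS (f : {ffun 'I_c -> 'I_k}) : measurable (S f).
  have -> : S f = (\bigcap_(i in [set: 'I_c]) [set w | r i w = f i])%classic.
    by apply/seteqP; split => w /= h i; [move=> _ | apply: h].
  apply: fin_bigcap_measurable => [|i _]; first exact: finite_finset.
  exact: (r_meas i [set f i]%classic).
have PS (f : {ffun 'I_c -> 'I_k}) : P (S f) = (\prod_i p (f i))%:E.
  have -> : S f = [set w | forall i, i \in [set: 'I_c]%SET ->
                           [set f i]%classic (r i w)]%classic.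
    by apply/seteqP; split => w /= h i; [move=> _ | apply: h; rewrite inE].
  rewrite (r_indep _ (fun i => [set f i]%classic)) -prodEFin; apply: eq_big => [i|i _]; first by rewrite inE.
  exact: r_law.
rewrite unlock.
transitivity (\int[P]_w (\sum_f (F f)%:E * (\1_(S f) w)%:E))%E.
  apply: eq_integral => w _.
  rewrite (bigD1 [ffun i => r i w]) //= big1 => [|f fr].
    by rewrite adde0 indicE mem_set ?mule1 // => i; rewrite ffunE.
  rewrite indicE memNset ?mule0 //= => h.
  by case/eqP: fr; apply/ffunP => i; rewrite ffunE h.
have iS f : P.-integrable [set: T] (fun w => (\1_(S f) w)%:E).
  exact: integrable_indic.
rewrite integral_sum //=; last by move=> f; exact: integrableZl.
rewrite -sumEFin; apply: eq_bigr => f _.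
by rewrite integralZl // integral_indic // setIT [X in (_ * X)%E]PS -EFinM mulrC.
Qed.

(** That p has total mass 1 follows from the existence of one sample: the law of
    the tuple has total mass (sum p)^c, which is 1, and the sum is
    nonnegative. *)
Lemma samples_sum1 (c_gt0 : (0 < c)%N) : \sum_l p l = 1.
Proof.
have p_ge0 l : 0 <= p l.
  case: r_samples => _ r_law _.
  by rewrite -lee_fin -(r_law (Ordinal c_gt0)).
apply/eqP; rewrite -(@pexpr_eq1 _ _ c) ?sumr_ge0 // -sum_prod_pmf -eqe.
rewrite -(expectation_cst P 1) (expectation_samples (cst 1)).
by under [in eqbRHS]eq_bigr do rewrite mulr1.
Qed.

(** The squared Frobenius norm is a sum over entries, and the (a, b) entry of the
    estimator is the mean of c independent copies of X_l(a,b) / p_l, whose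
    expectation is the (a, b) entry of the sum of the X_l. *)
Lemma sampling_error (m q : nat) (X : 'I_k -> 'M[R]_(m, q)) :
  (0 < c)%N -> (forall l, p l != 0) ->
  ('E_P[fun w => (frob_norm (\sum_l X l -
      c%:R^-1 *: \sum_i (p (r i w))^-1 *: X (r i w)) ^+ 2)%R])%E
  = (c%:R^-1 * (\sum_l frob_norm (X l) ^+ 2 / p l
                - frob_norm (\sum_l X l) ^+ 2))%:E.
Proof.
move=> c_gt0 p_neq0.
pose F (f : {ffun 'I_c -> 'I_k}) := frob_norm (\sum_l X l -
  c%:R^-1 *: \sum_i (p (f i))^-1 *: X (f i)) ^+ 2.
transitivity ('E_P[fun w => F [ffun i => r i w]])%E.
  congr ('E_P[_])%E; apply/funext => w; rewrite /F.
  congr (frob_norm (_ - _ *: _) ^+ 2).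
  by apply: eq_bigr => i _; rewrite ffunE.
rewrite expectation_samples; congr (_%:E).
pose y a b l := X l a b / p l.
have py a b : \sum_l p l * y a b l = (\sum_l X l) a b.
  by rewrite summxE; apply: eq_bigr => l _; rewrite /y mulrC divfK.
transitivity (\sum_a \sum_b \sum_(f : {ffun 'I_c -> 'I_k}) (\prod_h p (f h)) *
     (\sum_l p l * y a b l - c%:R^-1 * \sum_i y a b (f i)) ^+ 2).
  under [RHS]eq_bigr do rewrite exchange_big.
  rewrite [RHS]exchange_big; apply: eq_bigr => f _ /=.
  rewrite /F sqr_frob_norm mulr_sumr; apply: eq_bigr => a _.
  rewrite mulr_sumr; apply: eq_bigr => b _.
  rewrite py !mxE [in X in _ - _ * X]summxE.
  congr (_ * (_ - _ * _) ^+ 2).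
  by apply: eq_bigr => i _; rewrite mxE mulrC.
under eq_bigr => a _ do
  under eq_bigr => b _ do rewrite (variance_of_mean (samples_sum1 c_gt0)) // py.
under eq_bigr do rewrite -mulr_sumr sumrB.
rewrite -mulr_sumr sumrB -sqr_frob_norm; congr (_ * (_ - _)).
under eq_bigr do rewrite exchange_big.
rewrite exchange_big; apply: eq_bigr => l _.
rewrite sqr_frob_norm mulr_suml; apply: eq_bigr => a _.
rewrite mulr_suml; apply: eq_bigr => b _.
by rewrite /y; field.
Qed.

End Samples.

(** * Merging indices into blocks *)

(** The two sides differ by the p-weighted squared deviations of x_j / p_j over
    J, that is, the sum of (x_j - mu p_j)^2 / p_j where mu is the weighted mean
    (sum x) / (sum p). *)
Lemma sqr_sum_div_le (R : realType) (I : finType) (J : {pred I})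
    (p x : I -> R) :
  (forall j, j \in J -> 0 < p j) ->
  (\sum_(j in J) x j) ^+ 2 / \sum_(j in J) p j <= \sum_(j in J) x j ^+ 2 / p j.
Proof.
move=> p_gt0; set X := \sum_(j in J) x j; set s := \sum_(j in J) p j.
have : 0 <= \sum_(j in J) (x j - X / s * p j) ^+ 2 / p j.
  apply: sumr_ge0 => j /p_gt0 pj.
  by rewrite divr_ge0 ?sqr_ge0 // ltW.
have -> : \sum_(j in J) (x j - X / s * p j) ^+ 2 / p j =
    \sum_(j in J) (x j ^+ 2 / p j - 2 * (X / s) * x j + (X / s) ^+ 2 * p j).
  by apply: eq_bigr => j /p_gt0 /lt0r_neq0 pj; move: (X / s) => mu; field.
rewrite big_split sumrB /= -!mulr_sumr -/X -/s => h; rewrite -subr_ge0.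
(* The sum s vanishes only for empty J; with 0^-1 = 0 the left-hand side is then
   0. *)
have [s0|s_neq0] := eqVneq s 0.
  by move: h; rewrite s0 invr0 !mulr0 mul0r addr0.
by apply: le_trans h _; rewrite le_eqVlt; apply/orP; left; apply/eqP; field.
Qed.

Lemma sqr_frob_norm_sum_div_le (R : realType) (I : finType) (J : {pred I})
    (m q : nat) (p : I -> R) (X : I -> 'M[R]_(m, q)) :
  (forall j, j \in J -> 0 < p j) ->
  frob_norm (\sum_(j in J) X j) ^+ 2 / \sum_(j in J) p j
  <= \sum_(j in J) frob_norm (X j) ^+ 2 / p j.
Proof.
move=> p_gt0; under [leRHS]eq_bigr do rewrite sqr_frob_norm mulr_suml.
rewrite exchange_big sqr_frob_norm mulr_suml; apply: ler_sum => a _ /=.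
under [leRHS]eq_bigr do rewrite mulr_suml.
rewrite exchange_big mulr_suml; apply: ler_sum => b _ /=.
by rewrite summxE; exact: sqr_sum_div_le.
Qed.

(** A family of k sets whose range is a partition with k members is injective, so
    summing over the indices of the family visits each block once. *)
Lemma sum_blocks (V : nmodType) (n k : nat) (Theta : 'I_k -> {set 'I_n})
    (F : 'I_n -> V) :
  finset.partition [set Theta l | l in 'I_k]%SET [set: 'I_n]%SET ->
  #|[set Theta l | l in 'I_k]%SET| = k ->
  \sum_l \sum_(j in Theta l) F j = \sum_j F j.
Proof.
move=> Theta_partition Theta_card.
have Theta_inj : {in 'I_k &, injective Theta}.
  by apply/finset.imset_injP; rewrite Theta_card card_ord.
transitivity (\sum_(j in [set: 'I_n]%SET) F j); last first.
  by apply: eq_bigl => j; rewrite inE.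
rewrite (finset.set_partition_big _ Theta_partition).
by rewrite (finset.big_imset _ Theta_inj).
Qed.

Theorem corollary3p4 (R : realType) (m n rho k c : nat)
    (A : 'M[R]_(m, n)) (B : 'M[R]_(n, rho)) (Theta : 'I_k -> {set 'I_n})
    (Theta_partition :
      finset.partition [set Theta l | l in 'I_k]%SET [set: 'I_n]%SET)
    (Theta_card : #|[set Theta l | l in 'I_k]%SET| = k)
    (c_ge1 : (1 <= c)%N)
    (p_gt0 : forall l : 'I_n, 0 < opt_prob A B l)
    (d : measure_display) (T : measurableType d) (P : probability T R)
    (r : 'I_c -> T -> 'I_k)
    (r_samples : independent_samples P (block_prob Theta (opt_prob A B)) r)
    (d' : measure_display) (T' : measurableType d') (P' : probability T' R)
    (t : 'I_c -> T' -> 'I_n)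
    (t_samples : independent_samples P' (opt_prob A B) t) :
  ('E_P[fun w => (frob_norm (A *m B -
       block_estimator Theta (block_prob Theta (opt_prob A B)) A B
         (fun i => r i w)) ^+ 2)%R]
   <= column_sampling_error P' (opt_prob A B) A B t)%E.
Proof.
set p := opt_prob A B in p_gt0 r_samples t_samples *.
pose X j := col j A *m row j B.
have block_gt0 l : 0 < block_prob Theta p l.
  have [j jl] : exists j, j \in Theta l.
    apply/set0Pn; apply: contraTneq Theta_partition => l0.
    by rewrite /finset.partition -l0 imset_f ?inE // !andbF.
  rewrite /block_prob (bigD1 j) //= ltr_pwDl // sumr_ge0 // => i _.
  exact: ltW.
have AB : A *m B = \sum_l \sum_(j in Theta l) X j.
  by rewrite sum_blocks // mulmx_sum_col_row.
rewrite /column_sampling_error.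
have -> : (fun w => frob_norm (A *m B - column_estimator p A B (t^~ w)) ^+ 2)
    = (fun w => frob_norm (\sum_j X j -
        c%:R^-1 *: \sum_i (p (t i w))^-1 *: X (t i w)) ^+ 2).
  by apply/funext => w; rewrite mulmx_sum_col_row.
have -> : (fun w => frob_norm (A *m B -
      block_estimator Theta (block_prob Theta p) A B (r^~ w)) ^+ 2)
    = (fun w => frob_norm (\sum_l \sum_(j in Theta l) X j -
        c%:R^-1 *: \sum_i (block_prob Theta p (r i w))^-1 *:
          \sum_(j in Theta (r i w)) X j) ^+ 2).
  apply/funext => w; rewrite AB /block_estimator.
  congr (frob_norm (_ - _ *: _) ^+ 2).
  by apply: eq_bigr => i _; rewrite mulmx_cols_rows_in.
rewrite (sampling_error r_samples (fun l => \sum_(j in Theta l) X j)) //;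
  last by move=> l; exact: lt0r_neq0.
rewrite (sampling_error t_samples X) //; last by move=> l; exact: lt0r_neq0.
rewrite sum_blocks // lee_fin ler_wpM2l ?invr_ge0 ?ler0n // lerB //.
rewrite -(sum_blocks (fun j => frob_norm (X j) ^+ 2 / p j)
  Theta_partition Theta_card).
by apply: ler_sum => l _; exact: sqr_frob_norm_sum_div_le.
Qed.
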